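(* Let $p\ge 3$ be a prime and let $a(n)=a_{1+x,p}(n)$ be the number of accessible $n$-blocks for the polynomial $1+x$ modulo $p$. Then, as formal power series in $z$, $$\sum_{n=0}^{\infty}a(n)z^n=\frac{1}{(1-z)^3}\bigg(1+(p-3)z+(p^2-3p+3)z^2+z^2\frac{(p-1)^2}{2}\sum_{i\ge 0}\Big(p\,z^{p^i}-2(p-1)z^{2p^i}+(p-2)z^{3p^i}\Big)\bigg).$$
   Context: For a prime $p$ and a polynomial $f(x)$ with integer coefficients, ''row $i$'' is the string of coefficients of $f(x)^i$ reduced modulo $p$, ordered by increasing powers of $x$ (from $x^0$ up to $x^{\deg f^i}$). An $m$-block is a string of $m$ residues modulo $p$; it is accessible if it occurs as a substring of consecutive entries of row $i$ for some $i\ge0$. $a_{f,p}(m)$ is the number of accessible $m$-blocks, with the convention $a_{f,p}(0)=1$. *)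

(* Defs.v *)
From HB Require Import structures.
From mathcomp Require Import all_boot all_order all_algebra.
From mathcomp Require Import boolp.

Set Implicit Arguments.
Unset Strict Implicit.
Unset Printing Implicit Defensive.

Import GRing.Theory.
Local Open Scope ring_scope.

(* Equality and choice on fps are classical (boolp). *)
Record fps (R : Type) := Fps { fps_coef : nat -> R }.

HB.instance Definition _ (R : Type) := gen_eqMixin (fps R).
HB.instance Definition _ (R : Type) := gen_choiceMixin (fps R).

Lemma fpsP (R : Type) (f g : fps R) : fps_coef f =1 fps_coef g <-> f = g.
Proof.
split=> [|->//]; case: f => f; case: g => g /= fg.
by congr Fps; apply: funext.
Qed.

Section Zmodule.
Variable R : zmodType.
Implicit Types f g h : fps R.

Definition fps_zero : fps R := Fps (fun=> 0).
Definition fps_opp f := Fps (fun n => - fps_coef f n).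
Definition fps_add f g := Fps (fun n => fps_coef f n + fps_coef g n).

Fact fps_addA : associative fps_add.
Proof. by move=> f g h; apply/fpsP => n /=; rewrite addrA. Qed.
Fact fps_addC : commutative fps_add.
Proof. by move=> f g; apply/fpsP => n /=; rewrite addrC. Qed.
Fact fps_add0 : left_id fps_zero fps_add.
Proof. by move=> f; apply/fpsP => n /=; rewrite add0r. Qed.
Fact fps_addN : left_inverse fps_zero fps_opp fps_add.
Proof. by move=> f; apply/fpsP => n /=; rewrite addNr. Qed.

HB.instance Definition _ := GRing.isZmodule.Build (fps R)
  fps_addA fps_addC fps_add0 fps_addN.

Lemma fps_coef0 n : fps_coef (0 : fps R) n = 0. Proof. by []. Qed.
Lemma fps_coefD f g n : fps_coef (f + g) n = fps_coef f n + fps_coef g n.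
Proof. by []. Qed.
Lemma fps_coefN f n : fps_coef (- f) n = - fps_coef f n. Proof. by []. Qed.
Lemma fps_coefB f g n : fps_coef (f - g) n = fps_coef f n - fps_coef g n.
Proof. by []. Qed.
Lemma fps_coef_sum I (r : seq I) (P : pred I) (F : I -> fps R) n :
  fps_coef (\sum_(i <- r | P i) F i) n = \sum_(i <- r | P i) fps_coef (F i) n.
Proof. by elim/big_rec2: _ => // i _ y _ <-. Qed.

End Zmodule.

Section Ring.
Variable R : comNzRingType.
Implicit Types f g h : fps R.

Definition fps_one : fps R := Fps (fun n => (n == 0)%:R).
Definition fps_mul f g := Fps (fun n =>
  \sum_(j < n.+1) fps_coef f j * fps_coef g (n - j)).

Definition fps_trunc N f : {poly R} := \poly_(i < N) fps_coef f i.

Lemma fps_mul_trunc N f g n : (n < N)%N ->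
  fps_coef (fps_mul f g) n = (fps_trunc N f * fps_trunc N g)`_n.
Proof.
move=> nN; rewrite coefM; apply: eq_bigr => j _.
rewrite !coef_poly (leq_ltn_trans (leq_subr _ _) nN).
by rewrite (leq_ltn_trans _ nN) // -ltnS.
Qed.

Fact fps_mulC : commutative fps_mul.
Proof. by move=> f g; apply/fpsP => n; rewrite !(@fps_mul_trunc n.+1)// mulrC. Qed.

Fact fps_mulA : associative fps_mul.
Proof.
move=> f g h; apply/fpsP => n.
pose T := fps_trunc n.+1.
transitivity (T f * T g * T h)`_n; last first.
  rewrite coefM /=; apply: eq_bigr => j _.
  by rewrite -fps_mul_trunc // coef_poly ltnS leq_subr.
rewrite -mulrA coefM /=; apply: eq_bigr => j _.
by rewrite -fps_mul_trunc ?ltnS ?leq_subr // coef_poly ltn_ord.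
Qed.

Fact fps_mul1 : left_id fps_one fps_mul.
Proof.
move=> f; apply/fpsP => n /=; rewrite big_ord_recl /= mul1r subn0.
by rewrite big1 ?addr0 // => i _; rewrite mul0r.
Qed.

Fact fps_mulDl : left_distributive fps_mul +%R.
Proof.
move=> f g h; apply/fpsP => n; rewrite fps_coefD -big_split /=.
by apply: eq_bigr => j _; rewrite mulrDl.
Qed.

Fact fps_one_neq0 : fps_one != 0.
Proof. by apply/eqP => /fpsP /(_ 0) /eqP; rewrite oner_eq0. Qed.

HB.instance Definition _ := GRing.Zmodule_isComNzRing.Build (fps R)
  fps_mulA fps_mulC fps_mul1 fps_mulDl fps_one_neq0.

Lemma fps_coef1 n : fps_coef (1 : fps R) n = (n == 0)%:R. Proof. by []. Qed.
Lemma fps_coefM f g n :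
  fps_coef (f * g) n = \sum_(j < n.+1) fps_coef f j * fps_coef g (n - j).
Proof. by []. Qed.

Definition fpsX : fps R := Fps (fun n => (n == 1)%:R).

Lemma fps_coefXn k n : fps_coef (fpsX ^+ k) n = (n == k)%:R.
Proof.
elim: k n => [|k IHk] n; first by rewrite expr0.
rewrite exprS fps_coefM; case: n => [|n].
  by rewrite big_ord_recl big_ord0 mul0r addr0.
rewrite big_ord_recl big_ord_recl /= mul0r add0r mul1r IHk subSS subn0 eqSS.
by rewrite big1 ?addr0 // => i _; rewrite mul0r.
Qed.

End Ring.

Section UnitRing.
Variable R : comUnitRingType.
Implicit Types f g : fps R.

(* fps_inv_seq f n = [:: g_0; ...; g_n] for g = 1/f, by the recursion
   g_(n+1) = - f_0^-1 * \sum_(j <= n) f_(n+1-j) * g_j. *)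
Fixpoint fps_inv_seq f n : seq R :=
  if n is m.+1 then
    let s := fps_inv_seq f m in
    rcons s (- (fps_coef f 0)^-1 * \sum_(j < n) fps_coef f (n - j) * s`_j)
  else [:: (fps_coef f 0)^-1].

Definition fps_unit : pred (fps R) := fun f => fps_coef f 0 \is a GRing.unit.
Definition fps_inv f :=
  if fps_unit f then Fps (fun n => (fps_inv_seq f n)`_n) else f.

Lemma size_fps_inv_seq f n : size (fps_inv_seq f n) = n.+1.
Proof. by elim: n => //= n IHn; rewrite size_rcons IHn. Qed.

Lemma nth_fps_inv_seq f n j : (j <= n)%N ->
  (fps_inv_seq f n)`_j = (fps_inv_seq f j)`_j.
Proof.
elim: n => [|n IHn]; first by rewrite leqn0 => /eqP ->.
rewrite leq_eqVlt => /predU1P[-> //|jn]; rewrite ltnS in jn.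
by rewrite /= nth_rcons size_fps_inv_seq ltnS jn IHn.
Qed.

Fact fps_mulV : {in fps_unit, left_inverse 1 fps_inv *%R}.
Proof.
move=> f uf; have uf0 : fps_coef f 0 \is a GRing.unit by [].
rewrite /fps_inv ifT //; apply/fpsP => n; rewrite fps_coefM fps_coef1.
rewrite big_ord_recr /= subnn; case: n => [|n].
  by rewrite big_ord0 add0r mulVr.
rewrite nth_rcons size_fps_inv_seq ltnn eqxx mulrAC mulNr mulVr // mulN1r.
apply/eqP; rewrite subr_eq0; apply/eqP; apply: eq_bigr => j _.
by rewrite [LHS]mulrC -(nth_fps_inv_seq f (leq_ord j)).
Qed.

Fact fps_unitPl f g : g * f = 1 -> fps_unit f.
Proof.
move=> /fpsP /(_ 0); rewrite fps_coefM fps_coef1 big_ord_recl big_ord0 addr0.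
by rewrite mulrC /fps_unit => fg; apply/unitrPr; exists (fps_coef g 0).
Qed.

Fact fps_inv_out : {in [predC fps_unit], fps_inv =1 id}.
Proof. by move=> f /negPf nuf; rewrite /fps_inv ifF. Qed.

HB.instance Definition _ := GRing.ComNzRing_hasMulInverse.Build (fps R)
  fps_mulV fps_unitPl fps_inv_out.

Lemma fps_unitE f : (f \is a GRing.unit) = (fps_coef f 0 \is a GRing.unit).
Proof. by []. Qed.

End UnitRing.

(* S is the sum of the series \sum_(i >= 0) F i: every coefficient of the
   partial sums is eventually constant, equal to that of S. *)
Definition fps_has_sum (R : zmodType) (F : nat -> fps R) (S : fps R) : Prop :=
  forall n, exists N, forall M, (N <= M)%N ->
    fps_coef (\sum_(i < M) F i) n = fps_coef S n.

(* The underlying sequence of f ^+ i lists its coefficients from 'X^0 up to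
   its degree over int, before reduction. *)
Definition coef_row (f : {poly int}) (p i : nat) : seq 'F_p :=
  [seq c%:~R | c <- polyseq (f ^+ i)].

Definition accessible (f : {poly int}) (p : nat) (s : seq 'F_p) : Prop :=
  exists i, infix s (coef_row f p i).

Definition num_accessible (f : {poly int}) (p m : nat) : nat :=
  #|[set b : m.-tuple 'F_p | `[< accessible f b >]]|.

Lemma num_accessible0 f p : num_accessible f p 0 = 1%N.
Proof.
rewrite /num_accessible -[RHS](card_tuple 0 'F_p) -cardsT; congr #|pred_of_set _|.
apply/setP => b; rewrite !inE; apply/asboolP; exists 0%N.
by rewrite tuple0 infix0s.
Qed.

(* Main.v *)
(**
  Rows of Pascal's triangle mod p satisfy Lucas' rule: row p i + j is row i with
  every entry c replaced by c times row j, padded with zeros to length p.  Hence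
  a block of length n read at an offset congruent to w + j + 1 mod p is encoded
  by an accessible block of length (n + j + w) / p, and for n > 2 the number
  a(n) equals the sum of a((n + j + w) / p) over j, w < p, up to the blocks
  reachable from several pairs (j, w).  Consecutive binomial coefficients obey
  s_(k+1) (w + j + k + 2) + s_k (w + k + 1) = 0, which is linear in (j, w); so a
  block determines (j, w) unless all pairs (s_k, s_(k+1)) are proportional.
  This leaves 0, reached from all p^2 pairs, and the multiples of (1,0,..,0),
  (0,..,0,1) and (1,-1,1,..), each reached from the p pairs on a line.  Thus
  a(n) = sum_(j,w) a((n + j + w) / p) - (4p - 2)(p - 1), the second difference
  of a is invariant under n |-> n / p for n > 2, and the third difference is
  supported on p^i, 2 p^i and 3 p^i.
*)

Require Import Defs.
From HB Require Import structures.
From mathcomp Require Import all_boot all_order all_algebra.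
From mathcomp Require Import boolp.
From mathcomp Require Import zify ring.

Set Implicit Arguments.
Unset Strict Implicit.
Unset Printing Implicit Defensive.

Import GRing.Theory.
Local Open Scope ring_scope.

(** * Lucas' congruence, for p and for powers of p *)

Section Lucas.
Variables (p : nat) (p_prime : prime p).

Lemma natFp_eq0 n : ((n%:R : 'F_p) == 0) = (p %| n)%N.
Proof. by rewrite -(dvdn_pcharf (pchar_Fp p_prime)). Qed.

Lemma dvdn_fact_lt n : (n < p)%N -> ~~ (p %| n`!)%N.
Proof.
elim: n => [|n IHn] np; first by rewrite dvdn1; move: (prime_gt1 p_prime); lia.
rewrite factS Euclid_dvdM // negb_or IHn 1?ltnW // andbT.
by apply/negP => /dvdn_leq; lia.
Qed.

Lemma bin_natFp_neq0 n k : (k <= n < p)%N -> ('C(n, k)%:R : 'F_p) != 0.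
Proof.
move=> /andP[kn np]; rewrite natFp_eq0.
by apply: contra (dvdn_fact_lt np) => pC; rewrite -(bin_fact kn) dvdn_mulr.
Qed.

(** This is (1 + X)^p = 1 + X^p mod p read on coefficients: in Vandermonde's sum only the two end
    terms of row p survive. *)
Lemma bin_addp n k :
  ('C(p + n, k)%:R : 'F_p) = 'C(n, k)%:R + (if (p <= k)%N then 'C(n, k - p)%:R else 0).
Proof.
have p0 := prime_gt0 p_prime.
have term0 i : (0 < i < p)%N -> 'C(p, i)%:R = 0 :> 'F_p.
  by move=> ip; apply/eqP; rewrite natFp_eq0 prime_dvd_bin.
rewrite -binomial.Vandermonde natr_sum big_ord_recl /= bin0 mul1n subn0; congr (_ + _).
case: leqP => [pk|kp]; last first.
  apply: big1 => i _; rewrite natrM term0 ?mul0r //.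
  by rewrite /bump /=; case: i => i /=; lia.
have kP : (p.-1 < k)%N by lia.
rewrite (bigD1 (Ordinal kP)) //= /bump /= add1n prednK // binn mul1n.
rewrite big1 ?addr0 // => i /eqP ni; rewrite natrM add1n.
have [ip|ip] := ltnP i.+1 p; first by rewrite term0 ?mul0r.
rewrite bin_small ?mul0r // ltn_neqAle ip andbT.
by apply/eqP => pi; apply: ni; apply: val_inj => /=; rewrite pi.
Qed.

(** Induction on [i]: each further p added to the row invokes [bin_addp], which becomes Pascal's
    rule for [i]. *)
Lemma lucas i j q t : (j < p)%N -> (t < p)%N ->
  'C(p * i + j, p * q + t)%:R = 'C(i, q)%:R * 'C(j, t)%:R :> 'F_p.
Proof.
move=> jp tp; elim: i q => [|i IHi] q.
  rewrite muln0; case: q => [|q]; first by rewrite muln0 !add0n bin0 mul1r.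
  rewrite bin0n mul0r add0n bin_small //.
  by rewrite mulnS -addnA ltn_addr.
rewrite mulnS -addnA bin_addp; case: q => [|q].
  by have := IHi 0%N; rewrite muln0 !add0n leqNgt tp /= addr0 !bin0.
rewrite ifT; last by nia.
have -> : (p * q.+1 + t - p = p * q + t)%N by nia.
by rewrite !IHi binS natrD mulrDl.
Qed.

(** [lucas] strips the lowest base-p digits, K times in all. With K large this isolates a leading
    digit above any given row and position. *)
Lemma lucas_exp K i j q t : (j < p ^ K)%N -> (t < p ^ K)%N ->
  'C(p ^ K * i + j, p ^ K * q + t)%:R = 'C(i, q)%:R * 'C(j, t)%:R :> 'F_p.
Proof.
have p0 := prime_gt0 p_prime.
elim: K j t => [|K IHK] j t.
  by rewrite expn0 !ltnS !leqn0 => /eqP-> /eqP->; rewrite !addn0 !mul1n bin0 mulr1.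
rewrite expnSr => jp tp.
rewrite (divn_eq j p) (divn_eq t p) mulnAC [(_ * p * q)%N]mulnAC.
rewrite !addnA -!mulnDl ![(_ * p)%N]mulnC !lucas ?ltn_pmod //.
by rewrite IHK ?ltn_divLR // mulrA.
Qed.

End Lucas.

(** * Accessible words and their expansion by one base-p digit *)

Section Words.
Variables (p : nat) (p_prime : prime p).
Local Notation F := 'F_p.

(* Reading past the end of a row gives 0; blocks padded this way are
   accessible too, by [accessible_acc]. *)
Definition acc n (d : nat -> F) :=
  exists i o, forall k, (k < n)%N -> d k = 'C(i, o + k)%:R.

Lemma coef_row_binom i :
  coef_row (1 + 'X) p i = mkseq (fun k => 'C(i, k)%:R) i.+1.
Proof.
rewrite /coef_row; have -> : (1 + 'X) ^+ i = \poly_(k < i.+1) 'C(i, k)%:R :> {poly int}.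
  rewrite exprDn poly_def; apply: eq_bigr => k _.
  by rewrite expr1n mul1r -scaler_nat.
rewrite polyseq_poly ?binn ?oner_eq0 // -map_comp.
by apply: eq_map => k /=; rewrite natz -pmulrn.
Qed.

(** The leading digits contribute 'C(1, 0) = 1. Hence row i, padded with zeros to length p^K, opens
    a genuine later row. *)
Lemma binD_exp K i t : (i < p ^ K)%N -> (t < p ^ K)%N ->
  'C(p ^ K + i, t)%:R = 'C(i, t)%:R :> F.
Proof.
move=> iK tK; have := lucas_exp p_prime 1 0 iK tK.
by rewrite muln1 muln0 add0n mul1r.
Qed.

Lemma accessible_acc n (b : n.-tuple F) :
  accessible (1 + 'X) b <-> acc n (fun k => b`_k).
Proof.
split=> -[i].
  rewrite coef_row_binom => /infixP[s1 [s2 rowE]].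
  exists i, (size s1) => k kn.
  have lt_row : (size s1 + k < i.+1)%N.
    have := congr1 size rowE; rewrite size_mkseq !size_cat size_tuple; lia.
  have := congr1 (fun s => s`_(size s1 + k)) rowE; rewrite nth_mkseq // => ->.
  by rewrite nth_cat ltnNge leq_addr /= addKn nth_cat size_tuple kn.
(* K is so large that the block fits inside the padded copy of row i. *)
move=> [o bE]; pose K := (i + o + n).+1.
have ltK : (K < p ^ K)%N by rewrite ltn_expl // prime_gt1.
exists (p ^ K + i)%N; rewrite coef_row_binom.
have -> : tval b = take n (drop o (mkseq (fun k => 'C(p ^ K + i, k)%:R) (p ^ K + i).+1)).
  apply: (@eq_from_nth _ 0).
    rewrite size_tuple size_takel // size_drop size_mkseq; lia.
  move=> k; rewrite size_tuple => kn; rewrite nth_take // nth_drop nth_mkseq; last lia.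
  by rewrite binD_exp ?bE //; lia.
by apply: infix_trans (infix_take _ _) (infix_drop _ _).
Qed.

(* Row i occurs again in row p^K + i, after the initial p^K entries. *)
Lemma acc_pad n d N : acc n d ->
  exists i o, (N <= o)%N /\ forall k, (k < n)%N -> d k = 'C(i, o + k)%:R.
Proof.
move=> [i [o dE]]; pose K := (N + i + o + n).+1.
have ltK : (K < p ^ K)%N by rewrite ltn_expl // prime_gt1.
exists (p ^ K + i)%N, (p ^ K + o)%N; split=> [|k kn]; first lia.
have ltiK : (i < p ^ K)%N by lia.
have ltokK : (o + k < p ^ K)%N by lia.
have := lucas_exp p_prime 1 1 ltiK ltokK.
by rewrite !muln1 binn mul1r dE // addnA => ->.
Qed.

(* Shifting the offset by j + 1 makes (n + j + w) / p the exact number of entries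
   of row i that leave a nonzero trace in the block. *)
Definition acc_at j w n (d : nat -> F) :=
  exists i q, forall k, (k < n)%N -> d k = 'C(p * i + j, p * q + (w + j + 1 + k))%:R.

Lemma acc_at_acc j w n d : acc_at j w n d -> acc n d.
Proof.
move=> [i [q dE]]; exists (p * i + j)%N, (p * q + (w + j + 1))%N => k kn.
by rewrite dE // !addnA.
Qed.

Lemma acc_acc_at n d : acc n d -> exists j w : 'I_p, acc_at j w n d.
Proof.
have p0 := prime_gt0 p_prime.
(* An offset of at least 2p keeps the subtractions below from truncating. *)
move=> /(acc_pad (2 * p)) [i [o [leo dE]]].
have jp : (i %% p < p)%N by rewrite ltn_pmod.
have wp : ((o - i %% p - 1) %% p < p)%N by rewrite ltn_pmod.
exists (Ordinal jp), (Ordinal wp), (i %/ p)%N, ((o - i %% p - 1) %/ p)%N => k kn.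
rewrite dE // /=; congr (_%:R); congr binomial; first by rewrite mulnC -divn_eq.
have := divn_eq (o - i %% p - 1) p; lia.
Qed.

(* The truncated predecessor of 0 is harmless: for a position below p the
   binomial vanishes, as w + j + 1 + k > j. *)
Definition expand j w (c : nat -> F) k : F :=
  c ((w + j + 1 + k) %/ p).-1 * 'C(j, (w + j + 1 + k) %% p)%:R.

Lemma expand_acc_at (j w : 'I_p) n c :
  acc ((n + j + w) %/ p) c -> acc_at j w n (expand j w c).
Proof.
have p0 := prime_gt0 p_prime.
(* A positive offset q + 1 puts entry m - 1 of [c] at position q + m of row i. *)
move=> /(acc_pad 1) [i [o [o_gt0 cE]]]; case: o o_gt0 cE => // q _ cE; exists i, q => k kn.
have mE := divn_eq (w + j + 1 + k) p; have mp := ltn_pmod (w + j + 1 + k) p0.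
rewrite /expand; set m := ((w + j + 1 + k) %/ p)%N in mE *.
set t := ((w + j + 1 + k) %% p)%N in mE mp *.
have -> : (p * q + (w + j + 1 + k) = p * (q + m) + t)%N by rewrite mE; lia.
rewrite lucas //; case: (posnP m) => [m0|m_gt0].
  by rewrite (@bin_small j t) ?mulr0 //; lia.
rewrite cE; first by rewrite addSnnS prednK.
suff: (m <= (n + j + w) %/ p)%N by lia.
rewrite leq_divRL //; lia.
Qed.

Lemma acc_at_expand (j w : 'I_p) n d : acc_at j w n d ->
  exists2 c, acc ((n + j + w) %/ p) c & forall k, (k < n)%N -> d k = expand j w c k.
Proof.
have p0 := prime_gt0 p_prime.
move=> [i [q dE]]; exists (fun m => 'C(i, q.+1 + m)%:R); first by exists i, q.+1.
move=> k kn; rewrite dE // /expand.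
have mE := divn_eq (w + j + 1 + k) p; have mp := ltn_pmod (w + j + 1 + k) p0.
set m := ((w + j + 1 + k) %/ p)%N in mE *.
set t := ((w + j + 1 + k) %% p)%N in mE mp *.
have -> : (p * q + (w + j + 1 + k) = p * (q + m) + t)%N by rewrite mE; lia.
rewrite lucas //; case: (posnP m) => [m0|m_gt0].
  by rewrite (@bin_small j t) ?mulr0 //; lia.
by rewrite addSnnS prednK.
Qed.

(** Every entry of [c] leaves a nonzero trace: some k reads the copy of row j scaled by c m at a
    place t <= j, where 'C(j, t) is nonzero mod p. *)
Lemma expand_inj (j w : 'I_p) n c c' : (0 < n)%N ->
  (forall k, (k < n)%N -> expand j w c k = expand j w c' k) ->
  forall m, (m < (n + j + w) %/ p)%N -> c m = c' m.
Proof.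
have p0 := prime_gt0 p_prime; have wp := ltn_ord w; have jp := ltn_ord j.
move=> n0 cc' m; rewrite leq_divRL // => mn.
(* If the window starts no later than that copy, t = 0 serves. Otherwise m = 0 and the window starts
   within the copy, at t = w + j + 1 - p <= j. *)
have [k [t [kn [UE tj]]]] : exists k t, (k < n)%N /\
    (w + j + 1 + k = m.+1 * p + t)%N /\ (t <= j)%N.
  have [le_m|lt_m] := leqP (w + j + 1) (m.+1 * p).
    by exists (m.+1 * p - (w + j + 1))%N, 0%N; lia.
  case: m mn lt_m => [|m] mn lt_m; last by nia.
  by exists 0%N, (w + j + 1 - p)%N; lia.
have := cc' k kn; rewrite /expand UE divnMDl // modnMDl divn_small ?modn_small; try lia.
rewrite addn0 /=; apply: mulIf.
by apply: bin_natFp_neq0 => //; lia.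
Qed.

(** * Words read at several pairs: the linear relation and the rays *)

Lemma natFp_p : (p%:R : F) = 0.
Proof. by apply/eqP; rewrite natFp_eq0. Qed.

Lemma natFp_val (x : F) : (val x)%:R = x.
Proof. exact: natr_Zp. Qed.

(** Reduction mod p of (M + 1) 'C(N, M + 1) = (N - M) 'C(N, M), where N = j and M = w + j + 1 + k
    mod p. *)
Lemma acc_at_rel j w n d k : acc_at j w n d -> (k.+1 < n)%N ->
  d k.+1 * (w + j + k + 2)%:R + d k * (w + k + 1)%:R = 0.
Proof.
move=> [i [q dE]] kn; rewrite !dE //; last exact: ltnW.
rewrite (addnS (w + j + 1) k) (addnS (p * q)); set M := (p * q + _)%N.
have MpF : M%:R = (w + j + 1 + k)%:R :> F by rewrite /M natrD natrM natFp_p mul0r add0r.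
have [MP|PM] := leqP M (p * i + j); last by rewrite !bin_small ?mul0r ?addr0 //; lia.
have : M.+1%:R * 'C(p * i + j, M.+1)%:R = (p * i + j - M)%:R * 'C(p * i + j, M)%:R :> F.
  by rewrite -!natrM mul_bin_left.
rewrite -natr1 natrB // MpF [(p * i + j)%:R]natrD natrM natFp_p => binE.
have -> : (w + j + k + 2)%:R = (w + j + 1 + k)%:R + 1 :> F by rewrite natr1; congr (_%:R); lia.
rewrite mulrC binE !natrD; ring.
Qed.

(** Neighbours in row p^K - 1 add up to an inner entry of row p^K, which is 0. *)
Lemma bin_expB1 K t : (t < p ^ K)%N -> 'C((p ^ K).-1, t)%:R = (-1) ^+ t :> F.
Proof.
have pK0 : (0 < p ^ K)%N by rewrite expn_gt0 prime_gt0.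
elim: t => [|t IHt] tK; first by rewrite bin0.
have := lucas_exp p_prime 1 0 pK0 tK.
rewrite muln1 muln0 add0n addn0 bin0n mulr0 -{1}(prednK pK0) binS natrD.
rewrite IHt ?exprS; last exact: ltnW.
by move/eqP; rewrite addr_eq0 mulN1r => /eqP.
Qed.

Definition ray n (tau : 'I_3) k : F :=
  if val tau is 0 then (k == 0)%:R
  else if val tau is 1 then (k == n.-1)%:R else (-1) ^+ k.

(* [acc_at_ray]: the multiples of [ray n tau] are read exactly at the pairs
   (j, w) with p dividing [line n tau j w]. *)
Definition line n (tau : 'I_3) j w :=
  (if val tau is 0 then w + 1 else if val tau is 1 then w + (j + n) else j + 1)%N.

(** One instance of [acc_at_rel], at k = 0 or k = n - 2, forces the divisibility. Conversely an
    explicit row shows the ray; its leading digit supplies the scalar through [bin1]. *)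
Lemma acc_at_ray n d x tau (j w : 'I_p) : (2 < n)%N -> x != 0 ->
    (forall k, (k < n)%N -> d k = x * ray n tau k) ->
  acc_at j w n d <-> (p %| line n tau j w)%N.
Proof.
move=> n2 x0 dE; have p0 := prime_gt0 p_prime.
have [jp wp] := (ltn_ord j, ltn_ord w).
split=> [jwd|].
  rewrite -natFp_eq0 //; case: tau dE => -[|[|[|//]]] //= lt3 dE; rewrite /line /=.
  - have := acc_at_rel jwd (ltnW n2); rewrite !dE /ray //=; try lia.
    by rewrite mulr0 mul0r add0r mulr1 addn0 => /eqP; rewrite mulf_eq0 (negPf x0).
  - have := @acc_at_rel _ _ _ _ n.-2 jwd; rewrite !dE /ray /=; try lia.
    rewrite (_ : n.-2.+1 = n.-1) ?eqxx; last lia.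
    rewrite (_ : (n.-2 == n.-1) = false); last by apply/eqP; lia.
    rewrite mulr0 mul0r addr0 mulr1 (_ : w + j + n.-2 + 2 = w + (j + n))%N; last lia.
    by move=> relE; have /eqP := relE ltac:(lia); rewrite mulf_eq0 (negPf x0).
  - have := acc_at_rel jwd (ltnW n2); rewrite !dE /ray //=; try lia.
    rewrite expr1 expr0 !natrD => relE.
    have /eqP : x * (j%:R + 1) = 0 by rewrite -oppr0 -relE; ring.
    by rewrite mulf_eq0 (negPf x0).
pose K := (n + p)%N; have ltK : (K < p ^ K)%N by rewrite ltn_expl // prime_gt1.
have pKS : (p ^ K.+1 = p * p ^ K)%N by rewrite expnS.
have leK : (p ^ K <= p ^ K.+1)%N by rewrite leq_pexp2l.
case: tau dE => -[|[|[|//]]] //= lt3 dE; rewrite /line /=.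
- move=> /dvdn_leq lepw; have wE : w = p.-1 :> nat by lia.
  (* The window opens at p^(K+1) + j, on the last nonzero entry of a copy of row j. *)
  exists (p ^ K * val x)%N, (p ^ K).-1 => k kn; rewrite dE // /ray /=.
  have -> : (p * (p ^ K * val x) + j = p ^ K.+1 * val x + j)%N by rewrite pKS mulnA.
  have -> : (p * (p ^ K).-1 + (w + j + 1 + k) = p ^ K.+1 * 1 + (j + k))%N.
    by rewrite pKS wE; nia.
  rewrite lucas_exp ?bin1 ?natFp_val //; try lia.
  by case: k kn => [|k] kn; rewrite ?addn0 ?binn // bin_small ?mulr0 //; lia.
- move=> /dvdnP[c wE].
  (* The window closes on position p^(K+1), the first entry of a copy of row j; its other entries
     lie in the zeros before that copy. *)
  exists (p ^ K * val x)%N, (p ^ K - c)%N => k kn; rewrite dE // /ray /=.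
  have -> : (p * (p ^ K * val x) + j = p ^ K.+1 * val x + j)%N by rewrite pKS mulnA.
  have oE : (p * (p ^ K - c) + (w + j + 1 + k) + n.-1 = p ^ K.+1 + k)%N.
    by rewrite pKS; nia.
  have [->|/eqP kn1] := eqVneq k n.-1.
    have -> : (p * (p ^ K - c) + (w + j + 1 + n.-1) = p ^ K.+1 * 1 + 0)%N by lia.
    by rewrite lucas_exp ?bin1 ?bin0 ?natFp_val ?mulr1 //; lia.
  have -> : (p * (p ^ K - c) + (w + j + 1 + k) = p ^ K.+1 * 0 + (p ^ K.+1 + k - n.-1))%N by lia.
  rewrite lucas_exp //; try lia.
  by rewrite [in RHS](@bin_small j) ?mulr0 //; lia.
- move=> /dvdn_leq lepj; have jE : j = p.-1 :> nat by lia.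
  (* The window starts w places into a copy of the alternating row p^(K+1) - 1, and [y] absorbs the
     resulting sign. *)
  set y := x * (-1) ^+ w.
  exists (p ^ K * val y + (p ^ K).-1)%N, (p ^ K).-1 => k kn; rewrite dE // /ray /=.
  have -> : (p * (p ^ K * val y + (p ^ K).-1) + j = p ^ K.+1 * val y + (p ^ K.+1).-1)%N.
    by rewrite pKS mulnDr mulnA jE; nia.
  have -> : (p * (p ^ K).-1 + (w + j + 1 + k) = p ^ K.+1 * 1 + (w + k))%N.
    by rewrite pKS jE; nia.
  rewrite lucas_exp ?bin1 ?natFp_val ?bin_expB1 //; try lia.
  by rewrite exprD mulrA /y -(mulrA x) -expr2 sqrr_sign mulr1.
Qed.

(** Subtracting the relations of the two pairs leaves one whose coefficients do not depend on k, so
    [d] is geometric or supported on its last entry. *)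
Lemma acc_at_uniq_or_ray n d (j w j' w' : 'I_p) :
    acc_at j w n d -> acc_at j' w' n d -> (j, w) != (j', w') -> (2 < n)%N ->
  exists tau x, forall k, (k < n)%N -> d k = x * ray n tau k.
Proof.
move=> jwd jwd' neq n2.
pose dj : F := j%:R - j'%:R; pose dw : F := w%:R - w'%:R.
have val_inj_Fp (i i' : 'I_p) : (i%:R : F) - i'%:R = 0 -> i = i'.
  move=> /eqP; rewrite subr_eq0 => /eqP /(congr1 val) /=.
  by rewrite !val_Fp_nat // !modn_small // => /val_inj.
have rel k : (k.+1 < n)%N -> d k.+1 * (dw + dj) = - (d k * dw).
  move=> kn; have := acc_at_rel jwd kn; have := acc_at_rel jwd' kn.
  rewrite !natrD => e1 e2; apply/eqP; rewrite -subr_eq0 opprK; apply/eqP.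
  by rewrite -[RHS](subrr 0) -{1}e2 -e1 /dw /dj; ring.
have [s0|s0] := eqVneq (dw + dj) 0.
  have dw0 : dw != 0.
    apply: contra neq => /eqP dw0; apply/eqP; move: s0; rewrite dw0 add0r => dj0.
    by rewrite (val_inj_Fp _ _ dj0) (val_inj_Fp _ _ dw0).
  exists (Ordinal (isT : 1 < 3)%N), (d n.-1) => k kn; rewrite /ray /=.
  have [->|/eqP kn1] := eqVneq k n.-1; first by rewrite mulr1.
  have /eqP := rel k ltac:(lia); rewrite s0 !mulr0 eq_sym oppr_eq0 mulf_eq0.
  by rewrite (negPf dw0) orbF => /eqP.
pose la := - dw / (dw + dj).
have dS k : (k.+1 < n)%N -> d k.+1 = la * d k.
  move=> kn; apply: (mulIf s0); rewrite rel // /la mulrAC divfK //; ring.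
have dE k : (k < n)%N -> d k = d 0%N * la ^+ k.
  elim: k => [|k IHk] kn; first by rewrite mulr1.
  by rewrite dS // IHk 1?ltnW // exprS mulrCA.
have [d0|d0] := eqVneq (d 0%N) 0.
  by exists ord0, 0 => k kn; rewrite dE // d0 !mul0r.
have [la0|la0] := eqVneq la 0.
  by exists ord0, (d 0%N) => k kn; rewrite dE // la0 expr0n.
exists (Ordinal (isT : 2 < 3)%N), (d 0%N) => k kn; rewrite dE // /ray /=.
congr (_ * _ ^+ k).
(* Subtracting [la] times the first relation from the second leaves d 0 * la * (la + 1) = 0, so the
   ratio is -1. *)
have e0 := acc_at_rel jwd (ltnW n2); have e1 := acc_at_rel jwd n2.
move: e0 e1; rewrite (dS 1%N) // (dS 0%N) 1?ltnW // !natrD => e0 e1.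
have /eqP : d 0%N * (la * (la + 1)) = 0 by rewrite -[RHS](subrr 0) -{1}e1 -(mulr0 la) -e0; ring.
by rewrite mulf_eq0 (negPf d0) mulf_eq0 (negPf la0) /= addr_eq0 => /eqP.
Qed.

Lemma ray_inj n tau tau' x x' : (2 < p)%N -> (2 < n)%N -> x != 0 ->
    (forall k, (k < n)%N -> x * ray n tau k = x' * ray n tau' k) ->
  (tau, x) = (tau', x').
Proof.
move=> p2 n2 x0 xE.
have := xE 0%N ltac:(lia); have := xE 1%N ltac:(lia); have := xE n.-1 ltac:(lia).
have n10 : (n.-1 == 0)%N = false by apply/eqP; lia.
have n01 : (0 == n.-1)%N = false by apply/eqP; lia.
have n11 : (1 == n.-1)%N = false by apply/eqP; lia.
case: tau tau' xE => -[|[|[|//]]] //= lt3 [[|[|[|//]]] //= lt3'] _;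
  rewrite /ray /= ?n10 ?n01 ?n11 ?eqxx ?expr0 ?expr1 ?mulr0 ?mulr1 ?mulrN1 => en e1 e0;
  try (by rewrite e0 eqxx in x0);
  try (by rewrite en eqxx in x0);
  try (by congr (_, _) => //; exact: val_inj).
- by move: x0; rewrite e0 -oppr_eq0 -e1 eqxx.
- by move: x0; rewrite en -e0 mul0r eqxx.
- by move: x0; rewrite -oppr_eq0 e1 eqxx.
Qed.

Lemma acc2 n d : (n <= 2)%N -> (2 < p)%N -> acc n d.
Proof.
move=> n2 p2.
have [d0|d0] := eqVneq (d 0%N) 0.
  (* Row p * d 1 vanishes strictly between positions 0 and p and has d 1 at p. *)
  exists (p * val (d 1%N))%N, p.-1 => -[|[|k]] kn; last by lia.
    rewrite d0 addn0; have := @lucas p p_prime (val (d 1%N)) 0 0 p.-1.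
    by rewrite muln0 addn0 add0n => ->; rewrite ?bin0n ?(gtn_eqF (_ : 0 < p.-1)%N) ?mulr0 //; lia.
  have := @lucas p p_prime (val (d 1%N)) 0 1 0.
  rewrite !addn0 muln1 addn1 prednK ?prime_gt0 // => ->; rewrite ?prime_gt0 //.
  by rewrite bin1 bin0 mulr1 natFp_val.
pose la := d 1%N / d 0%N.
have lap : (val la < p)%N by have := ltn_ord la; rewrite [X in (_ < X)%N -> _]Fp_cast.
(* From position p on, this row carries d 0 times row [la], which begins 1, la. *)
exists (p * val (d 0%N) + val la)%N, p => k kn.
have := @lucas p p_prime (val (d 0%N)) (val la) 1 k lap ltac:(lia).
rewrite muln1 => ->; rewrite bin1 natFp_val; case: k kn => [|[|k]] kn; last by lia.
  by rewrite bin0 mulr1.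
by rewrite bin1 natFp_val /la mulrC divfK.
Qed.

Lemma eq_acc n d d' : (forall k, (k < n)%N -> d k = d' k) -> acc n d -> acc n d'.
Proof. by move=> dd' [i [o dE]]; exists i, o => k kn; rewrite -dd' ?dE. Qed.

Lemma eq_acc_at j w n d d' :
  (forall k, (k < n)%N -> d k = d' k) -> acc_at j w n d -> acc_at j w n d'.
Proof. by move=> dd' [i [o dE]]; exists i, o => k kn; rewrite -dd' ?dE. Qed.

(** * Counting words with the multiplicity of their pairs *)

Definition word n (d : nat -> F) : n.-tuple F := [tuple d i | i < n].

Lemma nth_word n d k : (k < n)%N -> (word n d)`_k = d k.
Proof. by move=> kn; rewrite -[k]/(val (Ordinal kn)) nth_mktuple. Qed.

Lemma eq_word n (s t : n.-tuple F) :
  (forall k, (k < n)%N -> s`_k = t`_k) -> s = t.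
Proof.
by move=> st; apply: val_inj; apply: (@eq_from_nth _ 0) => [|k];
  rewrite !size_tuple //; exact: st.
Qed.

Definition acc_words n : {set n.-tuple F} := [set s : n.-tuple F | `[< acc n (nth 0 s) >]].

Definition acc_at_words j w n : {set n.-tuple F} :=
  [set s : n.-tuple F | `[< acc_at j w n (nth 0 s) >]].

Lemma num_accessibleE n : num_accessible (1 + 'X) p n = #|acc_words n|.
Proof.
by apply: eq_card => s; rewrite !inE; apply: asbool_equiv_eq; exact: accessible_acc.
Qed.

(** [expand j w] is the bijection: injective by [expand_inj], onto by [acc_at_expand]. *)
Lemma card_acc_at_words (j w : 'I_p) n : (0 < n)%N ->
  #|acc_at_words j w n| = num_accessible (1 + 'X) p ((n + j + w) %/ p).
Proof.
move=> n0; rewrite num_accessibleE; set v := (_ %/ p)%N.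
pose h (c : v.-tuple F) := word n (expand j w (nth 0 c)).
rewrite -(@card_imset _ _ h); last first.
  move=> c c' /(congr1 (fun s : n.-tuple F => nth 0 s)) cc'.
  apply: eq_word; apply: (@expand_inj j w n) => // k kn.
  by have := congr1 (fun d => d k) cc'; rewrite !nth_word.
apply: eq_card => s; apply/idP/imsetP => [|[c]]; rewrite !inE.
  move=> /asboolP /acc_at_expand[c cacc sE]; exists (word v c).
    by rewrite inE; apply/asboolP; apply: eq_acc cacc => k kv; rewrite nth_word.
  apply: eq_word => k kn; rewrite nth_word // sE // /expand.
  have mE := divn_eq (w + j + 1 + k) p.
  have mp : ((w + j + 1 + k) %% p < p)%N by rewrite ltn_pmod ?prime_gt0.
  set m := ((w + j + 1 + k) %/ p)%N in mE *.
  have [m0|m_gt0] := posnP m.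
    have jp := ltn_ord j; rewrite (@bin_small j) ?mulr0 //; lia.
  rewrite nth_word // prednK // leq_divRL ?prime_gt0 //; lia.
move=> /asboolP cacc ->; apply/asboolP.
by apply: eq_acc_at (expand_acc_at cacc) => k kn; rewrite nth_word.
Qed.

Definition mult n (s : n.-tuple F) : nat :=
  (\sum_(j < p) \sum_(w < p) (s \in acc_at_words j w n))%N.

Lemma sum_mult n : (0 < n)%N ->
  (\sum_(s : n.-tuple F) mult s =
   \sum_(j < p) \sum_(w < p) num_accessible (1 + 'X) p ((n + j + w) %/ p))%N.
Proof.
move=> n0; rewrite exchange_big; apply: eq_bigr => j _.
rewrite exchange_big; apply: eq_bigr => w _.
by rewrite -card_acc_at_words // -sum1_card [RHS]big_mkcond; apply: eq_bigr => s _; case: (_ \in _).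
Qed.

Lemma sum_dvdn_addr c : (\sum_(w < p) (p %| w + c) = 1)%N.
Proof.
have p0 := prime_gt0 p_prime.
(* The only solution is -c mod p, written c * (p - 1). *)
have w0p : (c * p.-1 %% p < p)%N by rewrite ltn_pmod.
rewrite (bigD1 (Ordinal w0p)) //= big1 => [|w].
  by rewrite /dvdn modnDml -mulnSr prednK // modnMl.
move=> /eqP ww0; apply/eqP; rewrite eqb0; apply: contra_notN ww0 => pw.
apply: val_inj => /=; rewrite -[LHS](modn_small (ltn_ord w)); apply/eqP.
rewrite -(eqn_modDr c) -mulnSr prednK // modnMl; exact: pw.
Qed.

Lemma sum_line n tau : (\sum_(j < p) \sum_(w < p) (p %| line n tau j w) = p)%N.
Proof.
case: tau => -[|[|[|//]]] lt3; rewrite /line /=;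
  try (by rewrite (eq_bigr (fun=> 1%N)) ?sum1_card ?card_ord // => j _; rewrite sum_dvdn_addr).
(* The line of the alternating ray fixes j and leaves w free, so w is summed outside. *)
rewrite exchange_big.
by rewrite (eq_bigr (fun=> 1%N)) ?sum1_card ?card_ord // => j _; rewrite sum_dvdn_addr.
Qed.

Definition ray_words n : {set n.-tuple F} :=
  [set word n (fun k => tx.2 * ray n tx.1 k) | tx in setX setT [set~ 0]].

Lemma card_ray_words n : (2 < p)%N -> (2 < n)%N -> #|ray_words n| = (3 * p.-1)%N.
Proof.
move=> p2 n2; rewrite card_in_imset.
  by rewrite cardsX cardsT card_ord cardsC1 card_Fp.
move=> [tau x] [tau' x']; rewrite !inE /= => x0 _ eqw.
apply: (@ray_inj n) => // k kn.
by have := congr1 (fun s : n.-tuple F => s`_k) eqw; rewrite !nth_word.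
Qed.

Lemma mult_ray n s : (2 < n)%N -> s \in ray_words n -> mult s = p.
Proof.
move=> n2 /imsetP[[tau x]]; rewrite !inE /= => x0 sE.
rewrite -[RHS](sum_line n tau); apply: eq_bigr => j _; apply: eq_bigr => w _.
congr nat_of_bool; rewrite inE; apply/asboolP/idP;
  apply (@acc_at_ray n _ x) => // k kn; by rewrite sE nth_word.
Qed.

Definition zero_word n := word n (fun=> 0).

Lemma mult0 n : mult (zero_word n) = (p * p)%N.
Proof.
rewrite /mult (eq_bigr (fun=> p)) ?sum_nat_const ?card_ord // => j _.
rewrite (eq_bigr (fun=> 1%N)) ?sum1_card ?card_ord // => w _.
rewrite inE asboolT //; exists 0%N, 0%N => k kn; rewrite nth_word //.
by rewrite muln0 add0n bin_small //; have := ltn_ord j; lia.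
Qed.

Lemma acc_words_mult n s : (s \in acc_words n) = (0 < mult s)%N.
Proof.
rewrite inE; apply/asboolP/idP => [/acc_acc_at[j [w jw]]|].
  by rewrite /mult (bigD1 j) //= (bigD1 w) //= inE asboolT.
move=> mult_gt0; apply: contrapT => nacc; move: mult_gt0.
rewrite /mult big1 // => j _; rewrite big1 // => w _; apply/eqP; rewrite eqb0 inE.
by apply/asboolP => jw; apply: nacc; apply: acc_at_acc jw.
Qed.

Lemma mult_le1 n s : (2 < n)%N -> s != zero_word n -> s \notin ray_words n ->
  (mult s <= 1)%N.
Proof.
move=> n2 s0 sray; rewrite leqNgt; apply/negP => mult2.
have : s \in acc_words n by rewrite acc_words_mult ltnW.
rewrite inE => /asboolP /acc_acc_at[j [w jw]].
suff mult1 : mult s = 1%N by rewrite mult1 in mult2.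
rewrite /mult pair_big /= (bigD1 (j, w)) //= [X in (nat_of_bool X)]inE asboolT //.
rewrite big1 // => -[j' w'] /= neq; apply/eqP; rewrite eqb0 inE.
apply/negP => /asboolP jw'.
have [tau [x sE]] := acc_at_uniq_or_ray jw' jw neq n2.
have [x0|x0] := eqVneq x 0.
  move/eqP: s0; apply; apply: eq_word => k kn.
  by rewrite nth_word // sE // x0 mul0r.
move/negP: sray; apply; apply/imsetP; exists (tau, x); first by rewrite !inE.
by apply: eq_word => k kn; rewrite nth_word //= sE.
Qed.

(** The zero word counts p^2 times, each of the 3(p - 1) ray words p times, any other accessible
    word once. The excess p^2 - 1 + 3(p - 1)^2 is (4p - 2)(p - 1). *)
Lemma num_accessible_rec n : (2 < p)%N -> (2 < n)%N ->
  (num_accessible (1 + 'X) p n + (4 * p - 2) * (p - 1) =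
   \sum_(j < p) \sum_(w < p) num_accessible (1 + 'X) p ((n + j + w) %/ p))%N.
Proof.
move=> p2 n2; rewrite -sum_mult; last lia.
have zray : zero_word n \notin ray_words n.
  apply/imsetP => -[[tau x]]; rewrite !inE /= => x0 zE.
  have /(congr1 snd) /= x00 : (tau, x) = (tau, 0).
    apply: (@ray_inj n) => // k kn; rewrite mul0r.
    by have := congr1 (fun s : n.-tuple F => s`_k) zE; rewrite !nth_word.
  by rewrite x00 eqxx in x0.
have split_sum (f : n.-tuple F -> nat) : (\sum_s f s = f (zero_word n) +
    \sum_(s in ray_words n) f s +
    \sum_(s | (s \notin ray_words n) && (s != zero_word n)) f s)%N.
  rewrite (bigID (mem (ray_words n))) /=; rewrite [X in (_ + X)%N](bigD1 (zero_word n)) //=.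
  by rewrite addnCA addnA.
rewrite num_accessibleE -sum1_card big_mkcond /= !split_sum mult0 acc_words_mult mult0.
rewrite (eq_bigr (fun=> 1%N)); last first.
  by move=> s sray; rewrite acc_words_mult mult_ray ?prime_gt0.
rewrite [X in (_ = _ + X + _)%N](eq_bigr (fun=> p)); last by move=> s; exact: mult_ray.
rewrite !sum_nat_const card_ray_words // (eq_bigr (@mult n)).
  rewrite ifT ?muln_gt0 ?prime_gt0 //.
  have pE : p = (p - 3 + 3)%N by lia.
  by move: (p - 3)%N pE (\sum_(_ | _) _)%N => q -> S; nia.
move=> s /andP[sray s0]; have := mult_le1 n2 s0 sray; rewrite acc_words_mult.
by case: (mult s) => [|[|]].
Qed.

Lemma num_accessible_small n : (n <= 2)%N -> (2 < p)%N ->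
  num_accessible (1 + 'X) p n = (p ^ n)%N.
Proof.
move=> n2 p2; rewrite num_accessibleE -[RHS](_ : #|{: n.-tuple F}| = _); last first.
  by rewrite card_tuple card_Fp.
by apply: eq_card => s; rewrite inE asboolT //; exact: acc2.
Qed.

End Words.

(** * Differences of window sums *)

Section Windows.
Variables (p : nat) (p_gt0 : (0 < p)%N) (R : zmodType).
Implicit Types h : nat -> R.

(** Both sums sit in one window of p + 1 terms, with its first or its last term split off; the last
    is h((n + p) / p). *)
Lemma window_sum_diff h n :
  \sum_(w < p) h ((n.+1 + w) %/ p)%N - \sum_(w < p) h ((n + w) %/ p)%N
    = h (n %/ p).+1 - h (n %/ p)%N.
Proof.
have splitl : \sum_(w < p.+1) h ((n + w) %/ p)%N =
    h (n %/ p)%N + \sum_(w < p) h ((n.+1 + w) %/ p)%N.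
  rewrite big_ord_recl /= addn0; congr (_ + _).
  by apply: eq_bigr => w _; rewrite /bump /= add1n addnS addSn.
have splitr : \sum_(w < p.+1) h ((n + w) %/ p)%N =
    \sum_(w < p) h ((n + w) %/ p)%N + h (n %/ p).+1.
  by rewrite big_ord_recr /= -[X in (n + X)%N]mul1n addnC divnMDl // add1n.
apply/eqP; rewrite subr_eq addrAC eq_sym subr_eq; apply/eqP.
by rewrite addrC -splitr splitl addrC.
Qed.

Definition diff h n := h n.+1 - h n.

Lemma window2_sum_diff h n :
  \sum_(j < p) \sum_(w < p) h ((n.+1 + j + w) %/ p)%N
    - \sum_(j < p) \sum_(w < p) h ((n + j + w) %/ p)%N
  = \sum_(j < p) diff h ((n + j) %/ p)%N.
Proof.
by rewrite -sumrB; apply: eq_bigr => j _; rewrite addSn window_sum_diff.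
Qed.

End Windows.

(** * From the recurrence to the third difference *)

Section Recurrence.
Variables (p : nat) (p_ge3 : (2 < p)%N) (a : nat -> rat).
Local Notation P := (p%:R : rat).
Hypothesis a_small : forall n, (n <= 2)%N -> a n = P ^+ n.
Hypothesis a_rec : forall n, (2 < n)%N ->
  a n + (4 * P - 2) * (P - 1) =
  \sum_(j < p) \sum_(w < p) a ((n + j + w) %/ p)%N.

Local Notation e2 := (diff (diff a)).
Local Notation D n := (\sum_(j < p) diff a ((n + j) %/ p)%N).
Local Notation F n := (\sum_(j < p) \sum_(w < p) a ((n + j + w) %/ p)%N).

Let p_gt0 : (0 < p)%N. Proof. lia. Qed.

Lemma diff_rec n : (2 < n)%N -> diff a n = D n.
Proof.
move=> n2; rewrite -(window2_sum_diff p_gt0) -!a_rec //; last lia.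
by rewrite /diff; ring.
Qed.

(** Each of the two differences telescopes one of the two window sums. *)
Lemma diff2_rec n : (2 < n)%N -> e2 n = e2 (n %/ p)%N.
Proof.
by move=> n2; rewrite {1}/diff !diff_rec ?window_sum_diff //; lia.
Qed.

Lemma diff2_0 : e2 0 = (P - 1) ^+ 2.
Proof. by rewrite /diff !a_small //; ring. Qed.

(** While n < 3 <= p the quotient n / p is 0, so each step adds the constant [e2 0]. *)
Lemma window_diff_small n : (n <= 3)%N -> D n = P * (P - 1) + n%:R * (P - 1) ^+ 2.
Proof.
elim: n => [|n IHn] n3.
  rewrite (eq_bigr (fun=> P - 1)) => [|j _].
    by rewrite sumr_const card_ord -mulr_natl; ring.
  by rewrite add0n divn_small // /diff !a_small //; ring.
have : D n.+1 - D n = e2 0.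
  by rewrite window_sum_diff // divn_small //; lia.
rewrite diff2_0 IHn 1?ltnW // => /eqP; rewrite subr_eq => /eqP ->.
by rewrite -[in RHS]natr1; ring.
Qed.

Lemma sum_ord_natr : (\sum_(j < p) j%:R : rat) = P * (P - 1) / 2.
Proof.
elim: p => [|q IHq]; first by rewrite big_ord0 !mul0r.
by rewrite big_ord_recr /= IHq -natr1; field.
Qed.

Lemma window_small j : (j <= p)%N ->
  \sum_(w < p) a ((j + w) %/ p)%N = P + j%:R * (P - 1).
Proof.
elim: j => [|j IHj] jp.
  rewrite (eq_bigr (fun=> 1)) => [|w _].
    by rewrite sumr_const card_ord mul0r addr0.
  by rewrite add0n divn_small // a_small.
have := window_sum_diff p_gt0 a j; rewrite divn_small // IHj 1?ltnW //.
move=> /eqP; rewrite subr_eq => /eqP ->.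
by rewrite !a_small // -natr1; ring.
Qed.

Lemma window2_sum0 : F 0 = P ^+ 2 + (P - 1) * (P * (P - 1) / 2).
Proof.
rewrite -sum_ord_natr mulr_sumr.
rewrite (eq_bigr (fun j : 'I_p => P + (P - 1) * j%:R)) => [|j _].
  by rewrite big_split /= sumr_const card_ord -[P *+ p]mulr_natr expr2.
by rewrite add0n window_small 1?ltnW // mulrC.
Qed.

(** The recurrence at 3 involves only a 0, a 1 and a 2, as (3 + j + w) / p <= 2; its sum is F 0 + D
    0 + D 1 + D 2. *)
Lemma a3 : a 3 = P ^+ 2 + (P - 1) * (P * (P - 1) / 2) + 3 * P * (P - 1)
  + 3 * (P - 1) ^+ 2 - (4 * P - 2) * (P - 1).
Proof.
have step n : F n.+1 = F n + D n.
  by apply/eqP; rewrite addrC -subr_eq window2_sum_diff.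
apply/eqP; rewrite eq_sym subr_eq a_rec // !step window2_sum0 !window_diff_small //.
by apply/eqP; ring.
Qed.

(** Coefficient of z^n in the i-th summand of the lacunary series. *)
Definition term (i n : nat) : rat :=
  P * (n == p ^ i)%N%:R - 2 * (P - 1) * (n == 2 * p ^ i)%N%:R
    + (P - 2) * (n == 3 * p ^ i)%N%:R.

(** Stopping at i < n loses nothing, since p^i > n for i >= n. *)
Definition sigma n := \sum_(i < n) term i n.

Lemma term_ge i n : (n <= i)%N -> term i n = 0.
Proof.
move=> ni; have lti := ltn_expl i (ltac:(lia) : 1 < p)%N.
have nE c : (0 < c)%N -> (n == c * p ^ i)%N = false by move=> c0; apply/eqP; nia.
by rewrite /term -{1}(mul1n (p ^ i)%N) !nE // !mulr0 subr0 addr0.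
Qed.

Lemma sigma_widen n M : (n <= M)%N -> \sum_(i < M) term i n = sigma n.
Proof.
move=> nM; rewrite /sigma (big_ord_widen _ (term^~ n) nM) [RHS]big_mkcond.
by apply: eq_bigr => i _; case: ltnP => // /term_ge.
Qed.

(** The summands with i > 0 are supported on multiples of p, where they are the summands i - 1 at n
    / p. *)
Lemma sigma_rec n :
  sigma n = term 0 n + (if (p %| n)%N then sigma (n %/ p) else 0).
Proof.
rewrite -(@sigma_widen n n.+1) // big_ord_recl; congr (_ + _).
case: ifP => [/dvdnP[m ->]|pn]; last first.
  have nE c i : (n == c * p ^ i.+1)%N = false.
    by apply/eqP => nE; rewrite nE expnS dvdn_mull ?dvdn_mulr in pn.
  rewrite big1 // => i _; rewrite /term /= /bump add1n.
  by have := nE 1%N i; rewrite mul1n !nE => ->; rewrite !mulr0; ring.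
rewrite mulnK // -(@sigma_widen m (m * p)) ?leq_pmulr //.
have mE c i : (m * p == c * p ^ i.+1)%N = (m == c * p ^ i)%N.
  by rewrite expnSr mulnA eqn_pmul2r.
apply: eq_bigr => i _; rewrite /term /= /bump add1n !mE.
by have := mE 1%N i; rewrite !mul1n => ->.
Qed.

(** For n >= 3 both sides vanish unless p divides n + 1, and then reduce to n / p, by [diff2_rec]
    and [sigma_rec]. The cases n < 3 are computed. *)
Lemma diff3E n : diff e2 n = (P - 1) ^+ 2 / 2 * sigma n.+1.
Proof.
have e2_1 : e2 1 = (P - 1) ^+ 2 * (1 + P / 2).
  by rewrite /diff a3 !a_small //; field.
have e2_2 : e2 2 = (P - 1) ^+ 2 * (2 - P / 2).
  by rewrite {1}/diff (diff_rec (isT : 2 < 3)%N) window_diff_small // /diff a3 !a_small //; field.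
have [m] := ubnP n; elim: m n => // m IHm n; rewrite ltnS => le_nm; rewrite sigma_rec.
have [n3|n3] := leqP 3 n.
  have t0 : term 0 n.+1 = 0.
    have nE c : (c <= 3)%N -> (n.+1 == c)%N = false by move=> c3; apply/eqP; lia.
    by rewrite /term expn0 !muln1 !nE // !mulr0 subr0 addr0.
  rewrite {1}/diff (@diff2_rec n.+1) 1?(@diff2_rec n) //; last exact: ltnW.
  rewrite t0 add0r divnS //; case: ifP => [pn|_]; last by rewrite mulr0 add0n subrr.
  have m0 : (n %/ p < n)%N by rewrite ltn_Pdiv //; lia.
  by rewrite pn !add1n -IHm ?(leq_trans m0).
rewrite /term expn0; case: n n3 {le_nm} => [|[|[|//]]] _ /=.
- by rewrite gtnNdvd // 1?ltnW // {1}/diff diff2_0 e2_1; field.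
- by rewrite gtnNdvd // {1}/diff e2_1 e2_2; field.
(* For n = 2, [e2 3] is [e2 1] when p = 3 and [e2 0] otherwise. *)
have [p3|p3] := eqVneq p 3%N.
  rewrite p3 /= (_ : 3 %/ 3 = 1)%N // {1}/diff diff2_rec // p3 (_ : 3 %/ 3 = 1)%N //.
  by rewrite e2_1 e2_2 /sigma big_ord1 /term p3 /=; field.
rewrite gtnNdvd //; last lia.
by rewrite {1}/diff diff2_rec // divn_small ?diff2_0 ?e2_2; [field|lia].
Qed.

End Recurrence.

(** * Constant series *)

Section ConstantSeries.
Variable R : comNzRingType.
Implicit Types (c : R) (f : fps R).

(** As a ring morphism it gathers the scalars of the formula, the division by 2 included, into
    constants that act coefficientwise. *)
Definition fpsC c : fps R := Fps (fun n => if n is 0 then c else 0).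

Lemma fps_coefCM c f n : fps_coef (fpsC c * f) n = c * fps_coef f n.
Proof.
by rewrite fps_coefM big_ord_recl subn0 big1 ?addr0 // => i _; rewrite mul0r.
Qed.

Lemma fps_coefXM f n :
  fps_coef (fpsX R * f) n = if n is m.+1 then fps_coef f m else 0.
Proof.
rewrite fps_coefM big_ord_recl mul0r add0r; case: n => [|n]; first by rewrite big_ord0.
by rewrite big_ord_recl mul1r subSS subn0 big1 ?addr0 // => i _; rewrite mul0r.
Qed.

Fact fpsC_is_zmod_morphism : zmod_morphism fpsC.
Proof. by move=> c d; apply/fpsP => -[|n]; rewrite fps_coefB //= subr0. Qed.

Fact fpsC_is_monoid_morphism : monoid_morphism fpsC.
Proof.
split; first by apply/fpsP => -[|n].
by move=> c d; apply/fpsP => -[|n]; rewrite fps_coefCM //= mulr0.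
Qed.

HB.instance Definition _ := GRing.isZmodMorphism.Build _ _ fpsC fpsC_is_zmod_morphism.
HB.instance Definition _ := GRing.isMonoidMorphism.Build _ _ fpsC fpsC_is_monoid_morphism.

Lemma fps_coef_mul1BX f n : fps_coef ((1 - fpsX R) * f) n =
  if n is m.+1 then fps_coef f m.+1 - fps_coef f m else fps_coef f 0.
Proof. by rewrite mulrBl mul1r fps_coefB fps_coefXM; case: n => //=; rewrite subr0. Qed.

End ConstantSeries.

(** * The generating function *)

Theorem theorem2p7 (p : nat) (p_prime : prime p) (p_ge3 : (3 <= p)%N) :
  let z : fps rat := fpsX rat in
  let P : fps rat := p%:R in
  exists S : fps rat,
    fps_has_sum (fun i : nat =>
      P * z ^+ (p ^ i) - 2 * (P - 1) * z ^+ (2 * p ^ i)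
        + (P - 2) * z ^+ (3 * p ^ i)) S /\
    Fps (fun n : nat => (num_accessible (1 + 'X) p n)%:R) =
      1 / (1 - z) ^+ 3 *
        (1 + (P - 3) * z + (P ^+ 2 - 3 * P + 3) * z ^+ 2
           + z ^+ 2 * ((P - 1) ^+ 2 / 2) * S).
Proof.
move=> z P; have PE : P = fpsC (p%:R : rat) by rewrite rmorph_nat.
have natE k : k%:R = fpsC (k%:R : rat) by rewrite rmorph_nat.
exists (Fps (sigma p)); split.
  move=> n; exists n => M nM; rewrite fps_coef_sum [RHS]/= -(sigma_widen p_ge3 nM).
  apply: eq_bigr => i _; rewrite PE (natE 2) -(rmorph1 (@fpsC rat)) -!rmorphB -rmorphM.
  by rewrite fps_coefD fps_coefB !fps_coefCM !fps_coefXn.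
pose a n : rat := (num_accessible (1 + 'X) p n)%:R.
have a_small n : (n <= 2)%N -> a n = p%:R ^+ n.
  by move=> n2; rewrite /a num_accessible_small // natrX.
have a_rec n : (2 < n)%N -> a n + (4 * p%:R - 2) * (p%:R - 1) =
    \sum_(j < p) \sum_(w < p) a ((n + j + w) %/ p)%N.
  move=> n2; have := congr1 (fun m => m%:R : rat) (num_accessible_rec p_prime p_ge3 n2).
  rewrite natrD natrM !natrB ?natrM ?natr_sum; try lia.
  by move=> ->; apply: eq_bigr => j _; rewrite natr_sum.
have a_diff3 := diff3E p_ge3 a_small a_rec.
have u1 : (1 - z) ^+ 3 \is a GRing.unit.
  by rewrite unitrX // fps_unitE fps_coefB /= subr0 unitr1.
(* With the denominator cleared, the left side has third differences of [a] as coefficients. *)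
rewrite mul1r; apply: (mulrI u1); rewrite mulVKr //.
have -> : (P - 1) ^+ 2 / 2 = fpsC (((p%:R : rat) - 1) ^+ 2 / 2).
  by rewrite rmorph_div ?rmorphXn ?rmorphB ?rmorph1 ?rmorph_nat // unitfE.
have -> : P - 3 = fpsC (p%:R - 3 : rat) by rewrite rmorphB !rmorph_nat.
have -> : P ^+ 2 - 3 * P + 3 = fpsC ((p%:R : rat) ^+ 2 - 3 * p%:R + 3).
  by rewrite rmorphD rmorphB rmorphXn rmorphM !rmorph_nat.
have mul1B3 f : (1 - z) ^+ 3 * f = (1 - z) * ((1 - z) * ((1 - z) * f)).
  by rewrite !exprSr expr0 mul1r -!mulrA.
apply/fpsP => n.
rewrite mul1B3 [z ^+ 2 * _]mulrC -mulrA [z ^+ 2]expr2 -[z * z * Fps _]mulrA.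
rewrite !fps_coefD !fps_coefCM !fps_coef_mul1BX !fps_coefXM.
have zE k : fps_coef z k = (k == 1)%:R by [].
have coefE (f : nat -> rat) k : fps_coef (Fps f) k = f k by [].
(* Coefficients 0, 1, 2 come from [a_small]. Coefficient n + 3 is the third difference at n, and the
   factor z^2 turns its counterpart into sigma (n + 1), as in [diff3E]. *)
case: n => [|[|[|n]]]; rewrite ?fps_coef_mul1BX ?fps_coefXM !zE fps_coef1 !coefE -!/(a _) /=.
- by rewrite a_small // !mulr0 !addr0.
- by rewrite !a_small // !mulr0 mulr1 !addr0; ring.
- by rewrite !a_small // /sigma big_ord0 !mulr0 mulr1; ring.
by rewrite !mulr0 !add0r -a_diff3 /diff; ring.
Qed.
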